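(* Let $\mathbb{L}^3=\mathbb{R}^2\times\mathbb{R}$ with metric $d\rho^2+\rho^2d\theta^2-dt^2$. (a) For real numbers $I\neq0$, $b$ and $m\neq0$, the formulae $$t=\int\sqrt{\frac{\rho^2-b^2}{\rho^2+I^2}}\;\frac{I}{\rho}\,d\rho,\qquad \tilde\theta(\rho,\theta)=m\,\theta-mbI\int\frac{d\rho}{\rho\,\sqrt{\rho^2+I^2}\,\sqrt{\rho^2-b^2}}$$ describe (for $\rho>|b|$) a family of maximal (zero mean curvature) space-like helicoidal surfaces $(\rho,\theta)\mapsto(\rho,\theta,t(\rho)+b\theta)$ in $\mathbb{L}^3$, where $\tilde\theta$ is a constant multiple of the natural parameter of the surface. This family contains, for $m=1$, $b=0$, the Lorentzian catenoid given by $\rho(t)=I\sinh(t/I)$. (b) Let $H\neq0$, let $I,b,s_0$ be real, $m\neq0$, and put $a=I-Hb^2$ and $c=\left|\frac{4H^2b^2+4Ha-1}{4H^4}\right|^{1/2}$. The functions $U=U(s)$ determined by $$m^2U^2=c\,\sinh\big(2H(s-s_0)\big)-\frac{1-2Ha}{2H^2}\quad\text{when }4H^2b^2+4Ha-1>0,$$ $$m^2U^2=c\,\cosh\big(2H(s-s_0)\big)-\frac{1-2Ha}{2H^2}\quad\text{when }4H^2b^2+4Ha-1<0,$$ describe families of space-like helicoidal surfaces of constant mean curvature $H$ in $\mathbb{L}^3$, parametrized by $(s,\tilde\theta)\mapsto(\rho(s),\theta(s,\tilde\theta),t(s)+b\,\theta(s,\tilde\theta))$ with $$\rho^2=m^2U^2+b^2,\qquad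 t=\int\frac{mU}{m^2U^2+b^2}\big(m^4U^2\dot U^2-m^2U^2-b^2\big)^{1/2}ds,$$ $$\theta=\frac{\tilde\theta}{m}+\int\frac{b}{mU(m^2U^2+b^2)}\big(m^4U^2\dot U^2-m^2U^2-b^2\big)^{1/2}ds,$$ on any interval of $s$ where these are defined, the square root being taken with the sign of $a-Hm^2U^2$.
   Context: A helicoidal surface of pitch $b$ in $\mathbb{L}^3$ is one parametrized in cylindrical coordinates $(\rho,\theta,t)$ by $X(s,\theta)=(\rho(s),\theta,t(s)+b\theta)$; it is space-like if its induced metric is Riemannian. Its natural parameters $(s,\tilde\theta)$ are those in which the metric is $ds^2+U(s)^2d\tilde\theta^2$ with orthogonal coordinate curves, the helices being the curves $s=\mathrm{const}$. The dot denotes $d/ds$. Indefinite integrals are defined up to constants. Mean curvature is half the trace of $\langle D_vw,n\rangle$ with respect to the unit normal $$n=\frac1W\big(\rho\,\dot t\,\partial_\rho+b\,\rho^{-1}\dot\rho\,\partial_\theta+\rho\,\dot\rho\,\partial_t\big),\qquad W^2=\rho^2(\dot\rho^2-\dot t^2)-b^2\dot\rho^2,$$ for the parametrization $(\rho(s),\theta,t(s)+b\theta)$ with $\dot\rho>0$. *)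

(* Defs.v *)
From Stdlib Require Import Reals.
From Coquelicot Require Import Coquelicot.
Open Scope R_scope.

(** * Lorentz space, in the Cartesian coordinates (x, y, t) *)

Definition L3 : Type := (R * R * R)%type.

Definition cx (p : L3) : R := fst (fst p).
Definition cy (p : L3) : R := snd (fst p).
Definition ct (p : L3) : R := snd p.

Definition vadd (p q : L3) : L3 := (cx p + cx q, cy p + cy q, ct p + ct q).
Definition vscal (k : R) (p : L3) : L3 := (k * cx p, k * cy p, k * ct p).

(** [dx^2 + dy^2 - dt^2], which is [drho^2 + rho^2 dtheta^2 - dt^2] in
    cylindrical coordinates. *)
Definition lor (p q : L3) : R := cx p * cx q + cy p * cy q - ct p * ct q.

Definition cyl (rho theta t : R) : L3 := (rho * cos theta, rho * sin theta, t).

(** The coordinate fields of [cyl] at the point of coordinates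
    (rho, theta, t). *)
Definition d_rho (theta : R) : L3 := (cos theta, sin theta, 0).
Definition d_theta (rho theta : R) : L3 :=
  (- rho * sin theta, rho * cos theta, 0).
Definition d_t : L3 := (0, 0, 1).

(** * Parametrized surfaces X : D -> L^3, for an open domain D of the plane *)

Definition pd1 (f : R -> R -> R) (u v : R) : R := Derive (fun x => f x v) u.
Definition pd2 (f : R -> R -> R) (u v : R) : R := Derive (fun y => f u y) v.

Definition C1_on (D : R -> R -> Prop) (f : R -> R -> R) : Prop :=
  forall u v, D u v ->
    ex_derive (fun x => f x v) u /\ ex_derive (fun y => f u y) v /\
    continuity_2d_pt (pd1 f) u v /\ continuity_2d_pt (pd2 f) u v.

Definition C2_on (D : R -> R -> Prop) (f : R -> R -> R) : Prop :=
  C1_on D f /\ C1_on D (pd1 f) /\ C1_on D (pd2 f).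

Definition surf_C2 (D : R -> R -> Prop) (X : R -> R -> L3) : Prop :=
  C2_on D (fun u v => cx (X u v)) /\
  C2_on D (fun u v => cy (X u v)) /\
  C2_on D (fun u v => ct (X u v)).

(** Partial derivatives of an L^3-valued map; as the connection D of L^3 is
    flat, [vd1 (vd1 X)], [vd2 (vd1 X)], [vd2 (vd2 X)] are the covariant
    derivatives of the coordinate fields of X. *)
Definition vd1 (X : R -> R -> L3) (u v : R) : L3 :=
  (pd1 (fun a b => cx (X a b)) u v, pd1 (fun a b => cy (X a b)) u v,
   pd1 (fun a b => ct (X a b)) u v).
Definition vd2 (X : R -> R -> L3) (u v : R) : L3 :=
  (pd2 (fun a b => cx (X a b)) u v, pd2 (fun a b => cy (X a b)) u v,
   pd2 (fun a b => ct (X a b)) u v).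

Definition g11 (X : R -> R -> L3) (u v : R) : R := lor (vd1 X u v) (vd1 X u v).
Definition g12 (X : R -> R -> L3) (u v : R) : R := lor (vd1 X u v) (vd2 X u v).
Definition g22 (X : R -> R -> L3) (u v : R) : R := lor (vd2 X u v) (vd2 X u v).

Definition space_like (D : R -> R -> Prop) (X : R -> R -> L3) : Prop :=
  forall u v, D u v -> forall p q : R, (p <> 0 \/ q <> 0) ->
    let w := vadd (vscal p (vd1 X u v)) (vscal q (vd2 X u v)) in
    0 < lor w w.

(** The normal direction of a space-like surface is time-like. *)
Definition unit_normal (D : R -> R -> Prop) (X N : R -> R -> L3) : Prop :=
  forall u v, D u v ->
    lor (N u v) (vd1 X u v) = 0 /\ lor (N u v) (vd2 X u v) = 0 /\
    lor (N u v) (N u v) = -1.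

(** Half the trace, with respect to the induced metric g, of the bilinear form
    h(v, w) = <D_v w, N>: that is, half the sum of the g^{ij} h_{ij}. *)
Definition mean_curvature (X N : R -> R -> L3) (u v : R) : R :=
  let E := g11 X u v in let F := g12 X u v in let G := g22 X u v in
  let det := E * G - F ^ 2 in
  let h11 := lor (vd1 (vd1 X) u v) (N u v) in
  let h12 := lor (vd2 (vd1 X) u v) (N u v) in
  let h22 := lor (vd2 (vd2 X) u v) (N u v) in
  / 2 * (G / det * h11 + 2 * (- F / det * h12) + E / det * h22).

Definition space_like_cmc_surface (D : R -> R -> Prop) (X N : R -> R -> L3)
    (H : R) : Prop :=
  surf_C2 D X /\ space_like D X /\ unit_normal D X N /\
  (forall u v, D u v -> mean_curvature X N u v = H).

(** * Helicoidal surfaces *)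

Definition helicoid (b : R) (rho t : R -> R) (s theta : R) : L3 :=
  cyl (rho s) theta (t s + b * theta).

Definition hel_W2 (b : R) (rho t : R -> R) (s : R) : R :=
  rho s ^ 2 * (Derive rho s ^ 2 - Derive t s ^ 2) - b ^ 2 * Derive rho s ^ 2.

(** The normal n of [helicoid b rho t] at the point of parameters (s, theta).
    The root W of [hel_W2] is an argument, since its sign fixes the
    orientation of n; n is future-directed when rho, rho' and W are positive. *)
Definition hel_normal (b : R) (rho t W : R -> R) (s theta : R) : L3 :=
  vscal (/ W s)
    (vadd (vadd (vscal (rho s * Derive t s) (d_rho theta))
                (vscal (b * / rho s * Derive rho s) (d_theta (rho s) theta)))
          (vscal (rho s * Derive rho s) d_t)).

(** [X : D -> L^3] is a parametrization of the helicoidal surface of pitch b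
    with generating curve (rho(s), t(s)), s in J. *)
Definition parametrizes_helicoidal (b : R) (J : R -> Prop) (rho t : R -> R)
    (D : R -> R -> Prop) (X : R -> R -> L3) : Prop :=
  (forall s, J s -> 0 < rho s) /\
  forall p : L3,
    (exists u v, D u v /\ p = X u v) <->
    (exists s theta, J s /\ p = helicoid b rho t s theta).

(** For a parametrization X : D -> L^3 of a helicoidal surface whose curves
    u = const are the helices, the functions S, T of (u, v) are natural
    parameters: coordinates such that the curves S = const are the helices and
    the induced metric is dS^2 + U(S)^2 dT^2. *)
Definition natural_parameters (D : R -> R -> Prop) (X : R -> R -> L3)
    (S : R -> R -> R) (U : R -> R) (T : R -> R -> R) : Prop :=
  C1_on D S /\ C1_on D T /\
  (forall u v u' v', D u v -> D u' v' -> (S u v = S u' v' <-> u = u')) /\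
  (forall u v u' v', D u v -> D u' v' ->
     S u v = S u' v' -> T u v = T u' v' -> u = u' /\ v = v') /\
  (forall u v, D u v ->
     g11 X u v = pd1 S u v ^ 2 + U (S u v) ^ 2 * pd1 T u v ^ 2 /\
     g12 X u v = pd1 S u v * pd2 S u v
                 + U (S u v) ^ 2 * (pd1 T u v * pd2 T u v) /\
     g22 X u v = pd2 S u v ^ 2 + U (S u v) ^ 2 * pd2 T u v ^ 2).

(** * The two families *)

Definition primitive_on (J : R -> Prop) (f F : R -> R) : Prop :=
  forall x, J x -> is_derive F x (f x).

(** The functions t(rho) and tildetheta(rho, theta) of the maximal family,
    for rho > |b|; both indefinite integrals are arbitrary primitives. *)
Definition maximal_family (I b m : R) (t : R -> R) (ttheta : R -> R -> R)
    : Prop :=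
  primitive_on (fun r => Rabs b < r)
    (fun r => sqrt ((r ^ 2 - b ^ 2) / (r ^ 2 + I ^ 2)) * (I / r)) t /\
  exists Q : R -> R,
    primitive_on (fun r => Rabs b < r)
      (fun r => 1 / (r * sqrt (r ^ 2 + I ^ 2) * sqrt (r ^ 2 - b ^ 2))) Q /\
    forall r theta, Rabs b < r -> ttheta r theta = m * theta - m * b * I * Q r.

Definition cmc_a (H I b : R) : R := I - H * b ^ 2.

Definition cmc_disc (H I b : R) : R :=
  4 * H ^ 2 * b ^ 2 + 4 * H * cmc_a H I b - 1.

Definition cmc_c (H I b : R) : R :=
  sqrt (Rabs (cmc_disc H I b / (4 * H ^ 4))).

(** The relation determining m^2 U^2 at s. *)
Definition cmc_U_equation (H I b m s0 : R) (U : R -> R) (s : R) : Prop :=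
  let k := (1 - 2 * H * cmc_a H I b) / (2 * H ^ 2) in
  (0 < cmc_disc H I b /\
     m ^ 2 * U s ^ 2 = cmc_c H I b * sinh (2 * H * (s - s0)) - k) \/
  (cmc_disc H I b < 0 /\
     m ^ 2 * U s ^ 2 = cmc_c H I b * cosh (2 * H * (s - s0)) - k).

Definition cmc_radicand (b m : R) (U : R -> R) (s : R) : R :=
  m ^ 4 * U s ^ 2 * Derive U s ^ 2 - m ^ 2 * U s ^ 2 - b ^ 2.

(** The square root of [cmc_radicand] having the sign of a - H m^2 U^2. *)
Definition cmc_root (H I b m : R) (U : R -> R) (s : R) : R :=
  sign (cmc_a H I b - H * m ^ 2 * U s ^ 2) * sqrt (cmc_radicand b m U s).

Definition cmc_dt (H I b m : R) (U : R -> R) (s : R) : R :=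
  m * U s / (m ^ 2 * U s ^ 2 + b ^ 2) * cmc_root H I b m U s.

Definition cmc_dtheta (H I b m : R) (U : R -> R) (s : R) : R :=
  b / (m * U s * (m ^ 2 * U s ^ 2 + b ^ 2)) * cmc_root H I b m U s.

(* Main.v *)
(** In a frame rotating with the angle [theta], the coordinate fields of a
    helicoidal surface and their derivatives have components depending only on
    the profile [rho(s), t(s)], so that the mean curvature condition becomes an
    ordinary differential equation for the profile, whatever the parameter
    along the helices.

    For (a), that equation with [rho = s] and [H = 0], solved for [t''], is
    satisfied by the given [t'] (its [t''] is [maximal_slope1]), and
    [S = sqrt (rho^2 + I^2)], [T = ttheta / m] are natural parameters.

    For (b), put [w = m U], [p = (w^2)' / 2] and [q = a - H w^2]. Both the
    [sinh] and the [cosh] relation amount to [p^2 = q^2 + w^2 + b^2], so that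
    the radicand is the perfect square [q^2] and the chosen root is [q]. With
    [p' = 1 - 2 H q] and [w w' = p], everything is then a rational identity
    in [rho, w, p, q]. *)

Require Import Defs.
From Stdlib Require Import Reals Lra.
From Coquelicot Require Import Coquelicot.
Open Scope R_scope.

Set Bullet Behavior "Strict Subproofs".

(** * Continuously differentiable functions of one and of two variables *)

(** The derivative is carried as an explicit function rather than as [Derive f], so that the first
    and second derivatives of a profile can enter algebraic identities directly. *)
Definition C1_with (J : R -> Prop) (f f1 : R -> R) : Prop :=
  forall s, J s -> is_derive f s (f1 s) /\ continuous f1 s.

Lemma C1_with_continuous (J : R -> Prop) (f f1 : R -> R) (s : R) :
  C1_with J f f1 -> J s -> continuous f s.
Proof.
  intros Hf Hs; apply (ex_derive_continuous f); exists (f1 s); apply Hf, Hs.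
Qed.

Lemma C1_with_const (J : R -> Prop) (k : R) : C1_with J (fun _ => k) (fun _ => 0).
Proof.
  intros s _; split; [exact (is_derive_const k s) | apply continuous_const].
Qed.

Lemma C1_with_plus (J : R -> Prop) (f f1 g g1 : R -> R) :
  C1_with J f f1 -> C1_with J g g1 ->
  C1_with J (fun s => f s + g s) (fun s => f1 s + g1 s).
Proof.
  intros Hf Hg s Hs; split.
  - apply (is_derive_plus f g); [apply Hf, Hs | apply Hg, Hs].
  - apply (continuous_plus f1 g1); [apply Hf, Hs | apply Hg, Hs].
Qed.

Lemma C1_with_mult (J : R -> Prop) (f f1 g g1 : R -> R) :
  C1_with J f f1 -> C1_with J g g1 ->
  C1_with J (fun s => f s * g s) (fun s => f1 s * g s + f s * g1 s).
Proof.
  intros Hf Hg s Hs; split.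
  - apply Derive.is_derive_mult; [apply Hf, Hs | apply Hg, Hs].
  - apply (continuous_plus (fun x => f1 x * g x) (fun x => f x * g1 x));
      [apply (continuous_mult f1 g) | apply (continuous_mult f g1)].
    + apply Hf, Hs.
    + exact (C1_with_continuous J g g1 s Hg Hs).
    + exact (C1_with_continuous J f f1 s Hf Hs).
    + apply Hg, Hs.
Qed.

Lemma locally_2d_fst (J : R -> Prop) (P : R -> R -> Prop) (s v : R) :
  open J -> J s -> (forall x y, J x -> P x y) -> locally_2d P s v.
Proof.
  intros HJ Hs HP; destruct (HJ s Hs) as [d Hd].
  exists d; intros x y Hx _; apply HP, Hd, Hx.
Qed.

Lemma continuity_2d_fst (f : R -> R) (s v : R) :
  continuous f s -> continuity_2d_pt (fun x _ => f x) s v.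
Proof.
  intros Hf; apply (continuity_1d_2d_pt_comp f (fun x _ => x)).
  - now apply continuity_pt_filterlim.
  - apply continuity_2d_pt_id1.
Qed.

(** [C1_on] speaks of [pd1] and [pd2], while computations produce closed forms. The two agree on the
    strip over [J], which is a neighbourhood of each of its points because [J] is open, so
    continuity transfers from the closed forms. *)
Lemma C1_on_intro (J : R -> Prop) (f f1 f2 : R -> R -> R) :
  open J ->
  (forall s v, J s -> is_derive (fun x => f x v) s (f1 s v)) ->
  (forall s v, J s -> is_derive (fun y => f s y) v (f2 s v)) ->
  (forall s v, J s -> continuity_2d_pt f1 s v) ->
  (forall s v, J s -> continuity_2d_pt f2 s v) ->
  C1_on (fun s _ => J s) f /\
  (forall s v, J s -> pd1 f s v = f1 s v /\ pd2 f s v = f2 s v).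
Proof.
  intros HJ H1 H2 K1 K2.
  assert (E1 : forall s v, J s -> f1 s v = pd1 f s v)
    by (intros s v Hs; symmetry; exact (is_derive_unique _ _ _ (H1 s v Hs))).
  assert (E2 : forall s v, J s -> f2 s v = pd2 f s v)
    by (intros s v Hs; symmetry; exact (is_derive_unique _ _ _ (H2 s v Hs))).
  split.
  - intros s v Hs; repeat split.
    + eexists; exact (H1 s v Hs).
    + eexists; exact (H2 s v Hs).
    + apply (continuity_2d_pt_ext_loc f1); [|now apply K1].
      now apply (locally_2d_fst J).
    + apply (continuity_2d_pt_ext_loc f2); [|now apply K2].
      now apply (locally_2d_fst J).
  - intros s v Hs; split; symmetry; auto.
Qed.

(** * Vector fields in the rotating frame *)

(** Components along the radial, the angular and the vertical unit vectors at
    angle [th]. *)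
Definition frame (th al be ga : R) : L3 :=
  (al * cos th - be * sin th, al * sin th + be * cos th, ga).

(** The three unit vectors are Lorentz-orthogonal of squares 1, 1 and -1 at every angle, so the
    angle drops out. *)
Lemma lor_frame (th al be ga al' be' ga' : R) :
  lor (frame th al be ga) (frame th al' be' ga') = al * al' + be * be' - ga * ga'.
Proof.
  unfold lor, frame, cx, cy, ct; simpl.
  generalize (sin2_cos2 th); unfold Rsqr; intros E.
  replace (al * al' + be * be')
    with ((al * al' + be * be') * (sin th * sin th + cos th * cos th))
    by (rewrite E; ring).
  ring.
Qed.

Definition surf_C1 (D : R -> R -> Prop) (X : R -> R -> L3) : Prop :=
  C1_on D (fun u v => cx (X u v)) /\
  C1_on D (fun u v => cy (X u v)) /\
  C1_on D (fun u v => ct (X u v)).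

Lemma surf_C2_intro (D : R -> R -> Prop) (X : R -> R -> L3) :
  surf_C1 D X -> surf_C1 D (vd1 X) -> surf_C1 D (vd2 X) -> surf_C2 D X.
Proof.
  intros (x & y & z) (x1 & y1 & z1) (x2 & y2 & z2).
  exact (conj (conj x (conj x1 x2))
          (conj (conj y (conj y1 y2)) (conj z (conj z1 z2)))).
Qed.

(** Increasing the angle turns the radial vector into the angular one and the angular one into minus
    the radial one; this produces the terms in [Q1] and [k]. Both partial derivatives are again of
    the form assumed for [V], with no term linear in [v] in the height, so the lemma can be applied
    first to a surface and then to its coordinate fields. *)
Lemma frame_field_C1 (J : R -> Prop) (V : R -> R -> L3) (k e : R)
    (Q Q1 al al1 be be1 ga ga1 : R -> R) :
  open J -> C1_with J Q Q1 ->
  C1_with J al al1 -> C1_with J be be1 -> C1_with J ga ga1 ->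
  (forall s v, J s ->
     V s v = frame (v * k + Q s) (al s) (be s) (ga s + e * v)) ->
  surf_C1 (fun s _ => J s) V /\
  (forall s v, J s ->
     vd1 V s v = frame (v * k + Q s) (al1 s - be s * Q1 s)
                       (be1 s + al s * Q1 s) (ga1 s) /\
     vd2 V s v = frame (v * k + Q s) (- (k * be s)) (k * al s) e).
Proof.
  intros HJ HQ Ha Hb Hc HV.
  assert (Cth : forall s v, J s ->
            continuity_2d_pt (fun x y => y * k + Q x) s v).
  { intros s v Hs; apply continuity_2d_pt_plus.
    - apply continuity_2d_pt_mult;
        [apply continuity_2d_pt_id2 | apply continuity_2d_pt_const].
    - apply continuity_2d_fst, (C1_with_continuous J Q Q1 s HQ Hs). }
  assert (Ccos : forall s v, J s ->
            continuity_2d_pt (fun x y => cos (y * k + Q x)) s v).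
  { intros s v Hs; apply (continuity_1d_2d_pt_comp cos (fun x y => y * k + Q x));
      [apply continuity_cos | auto]. }
  assert (Csin : forall s v, J s ->
            continuity_2d_pt (fun x y => sin (y * k + Q x)) s v).
  { intros s v Hs; apply (continuity_1d_2d_pt_comp sin (fun x y => y * k + Q x));
      [apply continuity_sin | auto]. }
  assert (C1 : forall f f1 s v, C1_with J f f1 -> J s ->
            continuity_2d_pt (fun x _ => f x) s v)
    by (intros f f1 s v Hf Hs;
        apply continuity_2d_fst, (C1_with_continuous J f f1 s Hf Hs)).
  assert (C1' : forall f f1 s v, C1_with J f f1 -> J s ->
            continuity_2d_pt (fun x _ => f1 x) s v)
    by (intros f f1 s v Hf Hs; apply continuity_2d_fst, Hf, Hs).
  (* The formula for [V] holds only over [J]: differentiating in [s] uses a neighbourhood inside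
     [J], whereas in the direction of [v] the whole line lies over [J]. *)
  assert (Hloc : forall (p : L3 -> R) s v (l : R), J s ->
    is_derive (fun x => p (frame (v * k + Q x) (al x) (be x) (ga x + e * v))) s l ->
    is_derive (fun x => p (V x v)) s l).
  { intros p s v l Hs; apply is_derive_ext_loc.
    destruct (HJ s Hs) as [d Hd]; exists d; intros x Hx.
    now rewrite HV by apply Hd, Hx. }
  assert (Hext : forall (p : L3 -> R) s v (l : R), J s ->
    is_derive (fun y => p (frame (y * k + Q s) (al s) (be s) (ga s + e * y))) v l ->
    is_derive (fun y => p (V s y)) v l)
    by (intros p s v l Hs; apply is_derive_ext; intros y; now rewrite HV).
  assert (Dv : forall f f1 s, C1_with J f f1 -> J s ->
            ex_derive f s /\ Derive (fun x => f x) s = f1 s).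
  { intros f f1 s Hf Hs; destruct (Hf s Hs) as [Hd _]; split.
    - now exists (f1 s).
    - now apply is_derive_unique. }
  destruct (C1_on_intro J (fun s v => cx (V s v))
    (fun s v => cx (frame (v * k + Q s) (al1 s - be s * Q1 s)
                          (be1 s + al s * Q1 s) (ga1 s)))
    (fun s v => cx (frame (v * k + Q s) (- (k * be s)) (k * al s) e))) as [X1 X2].
  1: exact HJ.
  5: destruct (C1_on_intro J (fun s v => cy (V s v))
    (fun s v => cy (frame (v * k + Q s) (al1 s - be s * Q1 s)
                          (be1 s + al s * Q1 s) (ga1 s)))
    (fun s v => cy (frame (v * k + Q s) (- (k * be s)) (k * al s) e))) as [Y1 Y2].
  5: exact HJ.
  9: destruct (C1_on_intro J (fun s v => ct (V s v))
    (fun s v => ct (frame (v * k + Q s) (al1 s - be s * Q1 s)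
                          (be1 s + al s * Q1 s) (ga1 s)))
    (fun s v => ct (frame (v * k + Q s) (- (k * be s)) (k * al s) e))) as [Z1 Z2].
  9: exact HJ.
  13: { split; [now split|]. intros s v Hs.
        destruct (X2 s v Hs) as [X3 X4], (Y2 s v Hs) as [Y3 Y4],
          (Z2 s v Hs) as [Z3 Z4].
        unfold vd1, vd2; rewrite X3, X4, Y3, Y4, Z3, Z4; now split. }
  (* Each of the three coordinates leaves four goals: the derivative in [s], the derivative in [v],
     and the continuity of both. *)
  1, 5, 9: intros s v Hs; apply Hloc; trivial; unfold cx, cy, ct, frame; simpl;
    destruct (Dv Q Q1 s) as [? EQ], (Dv al al1 s) as [? Ea],
      (Dv be be1 s) as [? Eb], (Dv ga ga1 s) as [? Ec]; trivial;
    auto_derive; [repeat split; trivial |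
      rewrite ?EQ, ?Ea, ?Eb, ?Ec; ring].
  1, 4, 7: intros s v Hs; apply Hext; trivial; unfold cx, cy, ct, frame; simpl;
    auto_derive; [repeat split; trivial | ring].
  all: intros s v Hs; unfold cx, cy, ct, frame; simpl;
    unfold Rminus;
    repeat (apply continuity_2d_pt_plus || apply continuity_2d_pt_opp
            || apply continuity_2d_pt_mult || apply continuity_2d_pt_const);
    eauto.
Qed.

(** * Metric, normal and mean curvature of a helicoidal surface *)

Lemma helicoid_frame (b : R) (rho t : R -> R) (s theta : R) :
  helicoid b rho t s theta = frame theta (rho s) 0 (t s + b * theta).
Proof. unfold helicoid, cyl, frame; do 2 f_equal; ring. Qed.

Lemma hel_normal_frame (b : R) (rho t W : R -> R) (s theta : R) :
  rho s <> 0 ->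
  hel_normal b rho t W s theta =
    frame theta (rho s * Derive t s / W s) (b * Derive rho s / W s)
                (rho s * Derive rho s / W s).
Proof.
  intros H; unfold hel_normal, vscal, vadd, d_rho, d_theta, d_t, frame, cx, cy, ct;
    simpl; unfold Rdiv; f_equal; [f_equal|];
    (* Abstracting the inverse keeps [field] from asking for [W s <> 0]. *)
    set (w := / W s); field; exact H.
Qed.

(** [v * k + Q s] is the angle of an arbitrary parametrization whose curves
    [s = const] are helices run through at constant speed. *)
Lemma helicoid_partials (J : R -> Prop) (b k : R)
    (rho rho1 rho2 t t1 t2 Q Q1 Q2 : R -> R) (X : R -> R -> L3) :
  open J ->
  C1_with J rho rho1 -> C1_with J rho1 rho2 ->
  C1_with J t t1 -> C1_with J t1 t2 ->
  C1_with J Q Q1 -> C1_with J Q1 Q2 ->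
  (forall s v, J s -> X s v = helicoid b rho t s (v * k + Q s)) ->
  surf_C2 (fun s _ => J s) X /\
  forall s v, J s ->
    let th := v * k + Q s in
    vd1 X s v = frame th (rho1 s) (rho s * Q1 s) (t1 s + b * Q1 s) /\
    vd2 X s v = frame th 0 (k * rho s) (k * b) /\
    vd1 (vd1 X) s v =
      frame th (rho2 s - rho s * Q1 s ^ 2) (2 * rho1 s * Q1 s + rho s * Q2 s)
            (t2 s + b * Q2 s) /\
    vd2 (vd1 X) s v = frame th (- k * rho s * Q1 s) (k * rho1 s) 0 /\
    vd2 (vd2 X) s v = frame th (- k ^ 2 * rho s) 0 0.
Proof.
  intros HJ Hr Hr1 Ht Ht1 HQ HQ1 HX.
  pose proof (C1_with_const J b) as Cb.
  pose proof (C1_with_const J 0) as C0.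
  pose proof (C1_with_const J k) as Ck.
  (* The height [t s + b * (v * k + Q s)] is a function of [s] plus a term linear in [v] of slope
     [b * k]. *)
  destruct (frame_field_C1 J X k (b * k) Q Q1 rho rho1 _ _ _ _ HJ HQ Hr C0
              (C1_with_plus _ _ _ _ _ Ht (C1_with_mult _ _ _ _ _ Cb HQ)))
    as [SX PX].
  { intros s v Hs; rewrite HX, helicoid_frame by exact Hs; f_equal; ring. }
  assert (P1 : forall s v, J s ->
    vd1 X s v = frame (v * k + Q s) (rho1 s) (rho s * Q1 s) (t1 s + b * Q1 s))
    by (intros s v Hs; rewrite (proj1 (PX s v Hs)); f_equal; ring).
  assert (P2 : forall s v, J s ->
    vd2 X s v = frame (v * k + Q s) 0 (k * rho s) (k * b))
    by (intros s v Hs; rewrite (proj2 (PX s v Hs)); f_equal; ring).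
  destruct (frame_field_C1 J (vd1 X) k 0 _ _ _ _ _ _ _ _ HJ HQ Hr1
              (C1_with_mult _ _ _ _ _ Hr HQ1)
              (C1_with_plus _ _ _ _ _ Ht1 (C1_with_mult _ _ _ _ _ Cb HQ1)))
    as [S1 PX1].
  { intros s v Hs; rewrite P1 by exact Hs; f_equal; ring. }
  destruct (frame_field_C1 J (vd2 X) k 0 _ _ _ _ _ _ _ _ HJ HQ C0
              (C1_with_mult _ _ _ _ _ Ck Hr) (C1_with_const J (k * b)))
    as [S2 PX2].
  { intros s v Hs; rewrite P2 by exact Hs; f_equal; ring. }
  split; [now apply surf_C2_intro|].
  intros s v Hs th; unfold th.
  destruct (PX1 s v Hs) as [E11 E12]; destruct (PX2 s v Hs) as [_ E22].
  rewrite P1, P2, E11, E12, E22 by exact Hs.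
  repeat split; f_equal; ring.
Qed.

(** The last hypothesis is the trace formula for [theta] itself as parameter
    ([k = 1], [Q = 0]), multiplied by [2 W^3]: a reparametrization of the
    surface does not change the mean curvature. *)
Lemma helicoid_cmc (J : R -> Prop) (b k H : R)
    (rho rho1 rho2 t t1 t2 Q Q1 Q2 W : R -> R) (X N : R -> R -> L3) :
  open J -> k <> 0 ->
  C1_with J rho rho1 -> C1_with J rho1 rho2 ->
  C1_with J t t1 -> C1_with J t1 t2 ->
  C1_with J Q Q1 -> C1_with J Q1 Q2 ->
  (forall s v, J s -> X s v = helicoid b rho t s (v * k + Q s)) ->
  (forall s v, J s -> N s v = hel_normal b rho t W s (v * k + Q s)) ->
  (forall s, J s -> rho s <> 0 /\ W s <> 0) ->
  (forall s, J s ->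
     W s ^ 2 = rho s ^ 2 * (rho1 s ^ 2 - t1 s ^ 2) - b ^ 2 * rho1 s ^ 2) ->
  (forall s, J s ->
     2 * H * W s ^ 3 =
       (rho s ^ 2 - b ^ 2) * rho s * (t1 s * rho2 s - rho1 s * t2 s)
       + 2 * b ^ 2 * t1 s * rho1 s ^ 2
       - (rho1 s ^ 2 - t1 s ^ 2) * rho s ^ 2 * t1 s) ->
  space_like_cmc_surface (fun s _ => J s) X N H /\
  forall s v, J s ->
    g11 X s v = rho1 s ^ 2 + (rho s * Q1 s) ^ 2 - (t1 s + b * Q1 s) ^ 2 /\
    g12 X s v = k * (rho s ^ 2 * Q1 s - b * (t1 s + b * Q1 s)) /\
    g22 X s v = k ^ 2 * (rho s ^ 2 - b ^ 2).
Proof.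
  intros HJ Hk Hr Hr1 Ht Ht1 HQ HQ1 HX HN Hnz HW2 HH.
  destruct (helicoid_partials J b k rho rho1 rho2 t t1 t2 Q Q1 Q2 X)
    as [SX PX]; trivial.
  assert (Hg : forall s v, J s ->
    g11 X s v = rho1 s ^ 2 + (rho s * Q1 s) ^ 2 - (t1 s + b * Q1 s) ^ 2 /\
    g12 X s v = k * (rho s ^ 2 * Q1 s - b * (t1 s + b * Q1 s)) /\
    g22 X s v = k ^ 2 * (rho s ^ 2 - b ^ 2)).
  { intros s v Hs; destruct (PX s v Hs) as (E1 & E2 & _).
    unfold g11, g12, g22; rewrite E1, E2, !lor_frame; repeat split; ring. }
  assert (HNf : forall s v, J s ->
    N s v = frame (v * k + Q s) (rho s * t1 s / W s) (b * rho1 s / W s)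
                  (rho s * rho1 s / W s)).
  { intros s v Hs; rewrite HN, hel_normal_frame by (try apply Hnz; exact Hs).
    now rewrite (is_derive_unique _ _ _ (proj1 (Ht s Hs))),
      (is_derive_unique _ _ _ (proj1 (Hr s Hs))). }
  (* [W s ^ 2] is the determinant for the parameters [s] and [theta]; the change to [s] and [v] has
     Jacobian [k]. *)
  assert (Hdet : forall s v, J s ->
    g11 X s v * g22 X s v - g12 X s v ^ 2 = k ^ 2 * W s ^ 2).
  { intros s v Hs; destruct (Hg s v Hs) as (-> & -> & ->); rewrite HW2 by exact Hs.
    ring. }
  split; [|exact Hg]; split; [exact SX|]; split; [|split].
  - intros s v Hs p q Hpq w.
    destruct (Hnz s Hs) as [_ HWn].
    assert (HW : 0 < W s ^ 2) by (apply pow2_gt_0; exact HWn).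
    assert (HK : 0 < k ^ 2) by (apply pow2_gt_0; exact Hk).
    (* Since [W^2 = (rho^2 - b^2) rho1^2 - rho^2 t1^2] is positive, [rho^2 - b^2] must be
       positive. *)
    assert (HG : 0 < g22 X s v).
    { destruct (Hg s v Hs) as (_ & _ & ->); apply Rmult_lt_0_compat; trivial.
      rewrite HW2 in HW by exact Hs.
      generalize (pow2_ge_0 (rho s * t1 s)) (pow2_ge_0 (rho1 s)); nra. }
    assert (HD : 0 < g11 X s v * g22 X s v - g12 X s v ^ 2)
      by (rewrite Hdet by exact Hs; now apply Rmult_lt_0_compat).
    assert (E : lor w w = p ^ 2 * g11 X s v + 2 * p * q * g12 X s v
                          + q ^ 2 * g22 X s v)
      by (unfold w, g11, g12, g22, lor, vadd, vscal, cx, cy, ct; simpl; ring).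
    (* Completing the square: [G] times the quadratic form is [(q G + p F)^2 + p^2 (E G - F^2)]. *)
    apply (Rmult_lt_reg_l (g22 X s v)); [exact HG|]; rewrite Rmult_0_r, E.
    replace (g22 X s v * (p ^ 2 * g11 X s v + 2 * p * q * g12 X s v
                          + q ^ 2 * g22 X s v))
      with ((q * g22 X s v + p * g12 X s v) ^ 2
            + p ^ 2 * (g11 X s v * g22 X s v - g12 X s v ^ 2)) by ring.
    destruct (Req_dec p 0) as [Hp|Hp].
    + destruct Hpq as [Hp'|Hq]; [contradiction|]; subst p.
      assert (0 < (q * g22 X s v) ^ 2) by (apply pow2_gt_0; nra).
      nra.
    + assert (0 < p ^ 2) by (apply pow2_gt_0; exact Hp).
      generalize (pow2_ge_0 (q * g22 X s v + p * g12 X s v)); nra.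
  - intros s v Hs; destruct (Hnz s Hs) as [_ HWn].
    destruct (PX s v Hs) as (E1 & E2 & _).
    rewrite HNf, E1, E2, !lor_frame by exact Hs; repeat split.
    + field; exact HWn.
    + field; exact HWn.
    + replace (-1) with (- (W s ^ 2 / W s ^ 2)) by (field; exact HWn).
      rewrite HW2 at 1 by exact Hs; field; exact HWn.
  - intros s v Hs; destruct (Hnz s Hs) as [_ HWn].
    unfold mean_curvature; cbv zeta; rewrite Hdet by exact Hs.
    destruct (Hg s v Hs) as (-> & -> & ->).
    destruct (PX s v Hs) as (_ & _ & -> & -> & ->).
    rewrite HNf, !lor_frame by exact Hs.
    (* Two factors [W] come from the determinant and one from the normal; all powers of [k] and all
       terms in [Q1], [Q2] cancel. *)
    apply (Rmult_eq_reg_l (2 * W s ^ 3));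
      [|apply Rmult_integral_contrapositive_currified;
        [lra | now apply pow_nonzero]].
    replace (2 * W s ^ 3 * H) with (2 * H * W s ^ 3) by ring.
    rewrite HH by exact Hs; field; now split.
Qed.

(** * The maximal family *)

Lemma C1_with_intro (J : R -> Prop) (f f1 : R -> R) :
  (forall s, J s -> is_derive f s (f1 s) /\ ex_derive f1 s) -> C1_with J f f1.
Proof.
  intros Hf s Hs; destruct (Hf s Hs) as [Hd He]; split; [exact Hd|].
  exact (ex_derive_continuous f1 s He).
Qed.

Lemma pos_of_Rabs_lt (b r : R) : Rabs b < r -> 0 < r /\ 0 < r ^ 2 - b ^ 2.
Proof.
  intros Hr; generalize (Rabs_pos b) (pow2_abs b); nra.
Qed.

Definition maximal_slope (I b r : R) : R :=
  sqrt ((r ^ 2 - b ^ 2) / (r ^ 2 + I ^ 2)) * (I / r).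

Definition maximal_slope1 (I b r : R) : R :=
  maximal_slope I b r * (2 * b ^ 2 - r ^ 2 + r ^ 2 * maximal_slope I b r ^ 2)
  / (r * (r ^ 2 - b ^ 2)).

Lemma maximal_slope_sqr (I b r : R) :
  Rabs b < r ->
  maximal_slope I b r ^ 2 = (r ^ 2 - b ^ 2) / (r ^ 2 + I ^ 2) * (I / r) ^ 2.
Proof.
  intros Hr; destruct (pos_of_Rabs_lt b r Hr) as [r0 rb].
  unfold maximal_slope; rewrite Rpow_mult_distr, pow2_sqrt; [reflexivity|].
  apply Rlt_le, Rdiv_lt_0_compat; nra.
Qed.

(** As [maximal_slope1] is the value of [t''] solved from the zero mean curvature equation, this is
    where the given slope is shown to satisfy that equation. *)
Lemma maximal_slope_C1 (I b : R) :
  C1_with (fun r => Rabs b < r) (maximal_slope I b) (maximal_slope1 I b).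
Proof.
  apply C1_with_intro; intros r Hr.
  destruct (pos_of_Rabs_lt b r Hr) as [r0 rb].
  assert (rI : 0 < r ^ 2 + I ^ 2) by nra.
  assert (Hq : 0 < (r ^ 2 - b ^ 2) / (r ^ 2 + I ^ 2))
    by now apply Rdiv_lt_0_compat.
  assert (Hd : is_derive (maximal_slope I b) r (maximal_slope1 I b r)).
  { assert (Hy : 0 < sqrt ((r ^ 2 - b ^ 2) / (r ^ 2 + I ^ 2)))
      by now apply sqrt_lt_R0.
    (* With the root named [y], [b^2 = r^2 - y^2 (r^2 + I^2)] eliminates [b], and the derivative
       formula becomes a rational identity in [r], [I], [y]. *)
    assert (Hy2 : (r ^ 2 - b ^ 2) =
      sqrt ((r ^ 2 - b ^ 2) / (r ^ 2 + I ^ 2)) ^ 2 * (r ^ 2 + I ^ 2))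
      by (rewrite pow2_sqrt by lra; field; lra).
    unfold maximal_slope1, maximal_slope; auto_derive;
      replace (r * (r * 1)) with (r ^ 2) by ring;
      replace (b * (b * 1)) with (b ^ 2) by ring;
      replace (I * (I * 1)) with (I ^ 2) by ring.
    - repeat split; lra.
    - change (r ^ 2 + - b ^ 2) with (r ^ 2 - b ^ 2).
      fold (Rdiv (r ^ 2 - b ^ 2) (r ^ 2 + I ^ 2)).
      revert Hy Hy2 rb;
        generalize (sqrt ((r ^ 2 - b ^ 2) / (r ^ 2 + I ^ 2))); intros y Hy Hy2 rb.
      assert (Hb : b ^ 2 = r ^ 2 - y ^ 2 * (r ^ 2 + I ^ 2)) by lra.
      rewrite Hb; field; repeat split; nra. }
  split; [exact Hd|].
  assert (ex_derive (maximal_slope I b) r) by (eexists; exact Hd).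
  unfold maximal_slope1; auto_derive; repeat split; trivial.
  intros E; rewrite !Rmult_1_r in E; nra.
Qed.

(** The natural parameters come from completing the square in the metric, [G (dtheta + (F/G) dr)^2 +
    ((E G - F^2)/G) dr^2]. Here [G = r^2 - b^2] is [U^2], the form [dtheta + (F/G) dr] integrates to
    [theta - b * I * Q r], and the last coefficient [r^2 / (r^2 + I^2)] is the square of the
    derivative of [sqrt (r ^ 2 + I ^ 2)]. *)
Lemma maximal_helicoid_natural (I b : R) (t Q : R -> R) :
  let J := fun r => Rabs b < r in
  let X := fun r theta => cyl r theta (t r + b * theta) in
  (forall r, J r -> is_derive t r (maximal_slope I b r)) ->
  (forall r, J r ->
     is_derive Q r (1 / (r * sqrt (r ^ 2 + I ^ 2) * sqrt (r ^ 2 - b ^ 2)))) ->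
  parametrizes_helicoidal b J (fun r => r) t (fun r _ => J r) X /\
  space_like_cmc_surface (fun r _ => J r) X
    (hel_normal b (fun r => r) t (fun r => sqrt (hel_W2 b (fun r => r) t r))) 0 /\
  natural_parameters (fun r _ => J r) X (fun r _ => sqrt (r ^ 2 + I ^ 2))
    (fun S => sqrt (S ^ 2 - I ^ 2 - b ^ 2)) (fun r theta => theta - b * I * Q r).
Proof.
  intros J X Ht HQ.
  assert (HJ : open J) by apply open_gt.
  assert (Cid : C1_with J (fun r => r) (fun _ => 1))
    by (intros r _; split; [exact (is_derive_id r) | apply continuous_const]).
  assert (Ct : C1_with J t (maximal_slope I b)).
  { intros r Hr; split; [now apply Ht|].
    exact (C1_with_continuous _ _ _ r (maximal_slope_C1 I b) Hr). }
  assert (HW2 : forall r, J r ->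
    hel_W2 b (fun r => r) t r =
      r ^ 2 * (1 ^ 2 - maximal_slope I b r ^ 2) - b ^ 2 * 1 ^ 2).
  { intros r Hr; unfold hel_W2.
    now rewrite Derive_id, (is_derive_unique _ _ _ (Ht r Hr)). }
  (* After substitution [W^2] is [(r^2 - b^2) r^2 / (r^2 + I^2)]. *)
  assert (HWpos : forall r, J r -> 0 < hel_W2 b (fun r => r) t r).
  { intros r Hr; destruct (pos_of_Rabs_lt b r Hr) as [r0 rb].
    rewrite HW2, maximal_slope_sqr by exact Hr.
    replace (r ^ 2 * (1 ^ 2 - (r ^ 2 - b ^ 2) / (r ^ 2 + I ^ 2) * (I / r) ^ 2)
             - b ^ 2 * 1 ^ 2)
      with ((r ^ 2 - b ^ 2) * (r ^ 2 / (r ^ 2 + I ^ 2))) by (field; nra).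
    apply Rmult_lt_0_compat; [exact rb|]; apply Rdiv_lt_0_compat; nra. }
  destruct (helicoid_cmc J b 1 0 (fun r => r) (fun _ => 1) (fun _ => 0)
    t (maximal_slope I b) (maximal_slope1 I b) (fun _ => 0) (fun _ => 0) (fun _ => 0)
    (fun r => sqrt (hel_W2 b (fun r => r) t r)) X
    (hel_normal b (fun r => r) t (fun r => sqrt (hel_W2 b (fun r => r) t r))))
    as [HX Hg]; trivial; try apply C1_with_const; try apply maximal_slope_C1.
  - intros r v _; unfold X, helicoid; f_equal; ring.
  - intros r v _; f_equal; ring.
  - intros r Hr; split.
    + destruct (pos_of_Rabs_lt b r Hr); lra.
    + apply Rgt_not_eq, sqrt_lt_R0, HWpos, Hr.
  - intros r Hr; rewrite pow2_sqrt by (apply Rlt_le, HWpos, Hr); now apply HW2.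
  - intros r Hr; destruct (pos_of_Rabs_lt b r Hr) as [r0 rb].
    unfold maximal_slope1; field; lra.
  - split; [|split; [exact HX|]].
    + split; [intros r Hr; now destruct (pos_of_Rabs_lt b r Hr)|].
      intros p; unfold X, helicoid; split; intros (r & v & Hr & Hp); now exists r, v.
    + assert (HB : forall r, J r -> 0 < sqrt (r ^ 2 + I ^ 2)).
      { intros r Hr; destruct (pos_of_Rabs_lt b r Hr); apply sqrt_lt_R0; nra. }
      assert (HA : forall r, J r -> 0 < sqrt (r ^ 2 - b ^ 2)).
      { intros r Hr; destruct (pos_of_Rabs_lt b r Hr); apply sqrt_lt_R0; nra. }
      destruct (C1_on_intro J (fun r _ => sqrt (r ^ 2 + I ^ 2))
        (fun r _ => r / sqrt (r ^ 2 + I ^ 2)) (fun _ _ => 0)) as [SC SD].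
      { exact HJ. }
      { intros r v Hr; generalize (HB r Hr);
          destruct (pos_of_Rabs_lt b r Hr); intros HB'.
        auto_derive; replace (r * (r * 1)) with (r ^ 2) by ring;
          replace (I * (I * 1)) with (I ^ 2) by ring; [nra | field; lra]. }
      { intros r v Hr; exact (is_derive_const _ v). }
      { intros r v Hr; generalize (HB r Hr);
          destruct (pos_of_Rabs_lt b r Hr); intros HB'.
        apply (continuity_2d_fst (fun r => r / sqrt (r ^ 2 + I ^ 2))).
        apply (ex_derive_continuous (fun r => r / sqrt (r ^ 2 + I ^ 2))).
        auto_derive; replace (r * (r * 1)) with (r ^ 2) by ring;
          replace (I * (I * 1)) with (I ^ 2) by ring; repeat split; nra. }
      { intros r v Hr; apply continuity_2d_pt_const. }
      set (q := fun r => 1 / (r * sqrt (r ^ 2 + I ^ 2) * sqrt (r ^ 2 - b ^ 2))) in *.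
      destruct (C1_on_intro J (fun r theta => theta - b * I * Q r)
        (fun r _ => - (b * I * q r)) (fun _ _ => 1)) as [TC TD].
      { exact HJ. }
      { intros r v Hr; auto_derive; [repeat split; now exists (q r); apply HQ|].
        replace (Derive (fun x => Q x) r) with (q r)
          by (symmetry; apply is_derive_unique, HQ, Hr).
        ring. }
      { intros r v Hr; auto_derive; trivial; ring. }
      { intros r v Hr; generalize (HB r Hr) (HA r Hr);
          destruct (pos_of_Rabs_lt b r Hr); intros HB' HA'.
        apply (continuity_2d_fst (fun r => - (b * I * q r))).
        apply (ex_derive_continuous (fun r => - (b * I * q r))).
        unfold q.
        auto_derive; replace (r * (r * 1)) with (r ^ 2) by ring;
          replace (I * (I * 1)) with (I ^ 2) by ring;
          replace (b * (b * 1)) with (b ^ 2) by ring; repeat split; try nra.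
        apply Rgt_not_eq; apply Rmult_lt_0_compat;
          [now apply Rmult_lt_0_compat | exact HA']. }
      { intros r v Hr; apply continuity_2d_pt_const. }
      assert (Hinj : forall r r', J r -> J r' ->
        sqrt (r ^ 2 + I ^ 2) = sqrt (r' ^ 2 + I ^ 2) -> r = r').
      { intros r r' Hr Hr' E.
        destruct (pos_of_Rabs_lt b r Hr), (pos_of_Rabs_lt b r' Hr').
        generalize (pow2_ge_0 r) (pow2_ge_0 r') (pow2_ge_0 I); intros r2 r2' I2.
        assert (E' : r ^ 2 + I ^ 2 = r' ^ 2 + I ^ 2) by (apply sqrt_inj; lra).
        apply Rsqr_inj; rewrite ?Rsqr_pow2; lra. }
      split; [exact SC|]; split; [exact TC|]; split; [|split].
      * intros r v r' v' Hr Hr'; split; [now apply Hinj | now intros ->].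
      * intros r v r' v' Hr Hr' ES ET.
        assert (E : r = r') by now apply Hinj.
        subst r'; split; [reflexivity | lra].
      * intros r v Hr.
        destruct (SD r v Hr) as [-> ->], (TD r v Hr) as [-> ->],
          (Hg r v Hr) as (-> & -> & ->).
        destruct (pos_of_Rabs_lt b r Hr) as [r0 rb].
        assert (HB2 : sqrt (r ^ 2 + I ^ 2) ^ 2 = r ^ 2 + I ^ 2)
          by (rewrite pow2_sqrt; nra).
        assert (HA2 : sqrt (r ^ 2 - b ^ 2) ^ 2 = r ^ 2 - b ^ 2)
          by (rewrite pow2_sqrt; nra).
        rewrite HB2, (pow2_sqrt (r ^ 2 + I ^ 2 - I ^ 2 - b ^ 2)) by lra.
        replace (r ^ 2 + I ^ 2 - I ^ 2 - b ^ 2) with (r ^ 2 - b ^ 2) by ring.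
        assert (Hs : maximal_slope I b r
          = sqrt (r ^ 2 - b ^ 2) / sqrt (r ^ 2 + I ^ 2) * (I / r))
          by (unfold maximal_slope; rewrite sqrt_div by nra; reflexivity).
        rewrite Hs; unfold q.
        generalize (HB r Hr) (HA r Hr); revert HA2 HB2;
          generalize (sqrt (r ^ 2 - b ^ 2)) (sqrt (r ^ 2 + I ^ 2));
          intros A B HA2 HB2 HB0 HA0.
        rewrite <- HA2.
        (* Expressing [b^2] and [I^2] by the two roots [A] and [B] makes the coefficient of [dr^2]
           rational in [r], [A], [B]. *)
        assert (Hb : b ^ 2 = r ^ 2 - A ^ 2) by lra.
        assert (HI : I ^ 2 = B ^ 2 - r ^ 2) by lra.
        repeat split.
        -- field_simplify; [|lra|lra]. rewrite HI, Hb; field; lra.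
        -- field; lra.
        -- lra.
Qed.

(** * The Lorentzian catenoid *)

(** The function [sinh] is odd, so the catenoid is even in [I], whereas the slope of the maximal
    family is odd in [I]. Hence the catenoid is matched with the member of parameter [Rabs I]. *)
Lemma scaled_sinh_abs (I tau : R) :
  I <> 0 -> I * sinh (tau / I) = Rabs I * sinh (tau / Rabs I).
Proof.
  intros HI; unfold Rabs; destruct (Rcase_abs I); [|reflexivity].
  replace (tau / - I) with (- (tau / I)) by (field; exact HI).
  unfold sinh; rewrite Ropp_involutive; field.
Qed.

Lemma catenoid_family (K : R) :
  0 < K ->
  maximal_family K 0 1 (fun r => K * arcsinh (r / K)) (fun _ theta => theta).
Proof.
  intros HK; split.
  - intros r Hr; destruct (pos_of_Rabs_lt 0 r Hr) as [r0 _].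
    assert (HB : 0 < sqrt (r ^ 2 + K ^ 2)) by (apply sqrt_lt_R0; nra).
    assert (E1 : sqrt ((r ^ 2 - 0 ^ 2) / (r ^ 2 + K ^ 2))
                 = r / sqrt (r ^ 2 + K ^ 2)).
    { rewrite sqrt_div by nra; f_equal.
      replace (r ^ 2 - 0 ^ 2) with (r ^ 2) by ring; apply sqrt_pow2; lra. }
    assert (E2 : sqrt ((r / K) ^ 2 + 1) = sqrt (r ^ 2 + K ^ 2) / K).
    { replace ((r / K) ^ 2 + 1) with ((r ^ 2 + K ^ 2) / K ^ 2) by (field; lra).
      rewrite sqrt_div by nra; f_equal; apply sqrt_pow2; lra. }
    rewrite E1.
    replace (r / sqrt (r ^ 2 + K ^ 2) * (K / r))
      with (K * (/ K * / sqrt ((r / K) ^ 2 + 1))) by (rewrite E2; field; lra).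
    apply is_derive_scal.
    apply (is_derive_comp arcsinh (fun x => x / K)).
    + apply is_derive_Reals, derivable_pt_lim_arcsinh.
    + auto_derive; trivial; field; lra.
  (* An elementary antiderivative of [1 / (r^2 sqrt (r^2 + K^2))], the integrand for [b = 0]. *)
  - exists (fun r => - sqrt (r ^ 2 + K ^ 2) / (K ^ 2 * r)); split.
    + intros r Hr; destruct (pos_of_Rabs_lt 0 r Hr) as [r0 _].
      assert (HB : 0 < sqrt (r ^ 2 + K ^ 2)) by (apply sqrt_lt_R0; nra).
      assert (HB2 : sqrt (r ^ 2 + K ^ 2) ^ 2 = r ^ 2 + K ^ 2)
        by (apply pow2_sqrt; nra).
      replace (r ^ 2 - 0 ^ 2) with (r ^ 2) by ring.
      rewrite (sqrt_pow2 r) by lra.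
      auto_derive; replace (r * (r * 1)) with (r ^ 2) by ring;
        replace (K * (K * 1)) with (K ^ 2) by ring.
      * assert (0 < K ^ 2 * r) by (apply Rmult_lt_0_compat; nra).
        repeat split; nra.
      * revert HB HB2; generalize (sqrt (r ^ 2 + K ^ 2)); intros B HB HB2.
        assert (HKB : K ^ 2 = B ^ 2 - r ^ 2) by lra.
        assert (K ^ 2 <> 0) by nra.
        rewrite HKB in *; field; repeat split; lra.
    + intros; ring.
Qed.

Lemma catenoid_points (K : R) (p : L3) :
  0 < K ->
  (exists r theta, Rabs 0 < r /\
     p = cyl r theta (K * arcsinh (r / K) + 0 * theta)) <->
  (exists tau theta, 0 < K * sinh (tau / K) /\ p = cyl (K * sinh (tau / K)) theta tau).
Proof.
  intros HK; rewrite Rabs_R0; split.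
  - intros (r & theta & Hr & ->); exists (K * arcsinh (r / K)), theta.
    replace (K * arcsinh (r / K) / K) with (arcsinh (r / K)) by (field; lra).
    rewrite sinh_arcsinh; replace (K * (r / K)) with r by (field; lra).
    split; [exact Hr | f_equal; ring].
  - intros (tau & theta & Hr & ->); exists (K * sinh (tau / K)), theta.
    split; [exact Hr | f_equal].
    replace (K * sinh (tau / K) / K) with (sinh (tau / K)) by (field; lra).
    rewrite arcsinh_sinh; field; lra.
Qed.

(** * The family of constant mean curvature *)

Ltac nonzero :=
  repeat split; trivial;
  repeat (apply Rmult_integral_contrapositive_currified); trivial; lra.

(** This isolates the geometry from the shape of [U]: only the differential system for [w], [p] and
    its first integral enter, so the [sinh] and [cosh] cases are treated at once. The root of
    [hel_W2] is [w] itself, whose sign may be negative and then reverses the normal. *)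
Lemma cmc_helicoid_natural (J : R -> Prop) (b H a m : R)
    (U w p rho t Q : R -> R) :
  let q := fun s => a - H * w s ^ 2 in
  let th := fun s v => v / m + Q s in
  let Y := fun s v => cyl (rho s) (th s v) (t s + b * th s v) in
  open J -> m <> 0 ->
  (forall s, J s -> w s = m * U s /\ w s <> 0) ->
  (forall s, J s -> is_derive w s (p s / w s)) ->
  (forall s, J s -> is_derive p s (1 - 2 * H * q s)) ->
  (forall s, J s -> p s ^ 2 = q s ^ 2 + w s ^ 2 + b ^ 2) ->
  (forall s, J s -> 0 <= rho s /\ rho s ^ 2 = w s ^ 2 + b ^ 2) ->
  (forall s, J s -> is_derive t s (w s * q s / (w s ^ 2 + b ^ 2))) ->
  (forall s, J s -> is_derive Q s (b * q s / (w s * (w s ^ 2 + b ^ 2)))) ->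
  parametrizes_helicoidal b J rho t (fun s _ => J s) Y /\
  (forall s, J s -> w s ^ 2 = hel_W2 b rho t s) /\
  space_like_cmc_surface (fun s _ => J s) Y
    (fun s v => hel_normal b rho t w s (th s v)) H /\
  natural_parameters (fun s _ => J s) Y (fun s _ => s) U (fun _ v => v).
Proof.
  intros q th Y HJ Hm Hw Dw Dp Hp Hrho Dt DQ.
  assert (Hrho0 : forall s, J s -> 0 < rho s).
  { intros s Hs; destruct (Hw s Hs) as [_ Hw0], (Hrho s Hs) as [Hr Hr2].
    assert (0 < w s ^ 2) by now apply pow2_gt_0.
    generalize (pow2_ge_0 b); nra. }
  assert (Drho : forall s, J s -> is_derive rho s (p s / rho s)).
  { intros s Hs; generalize (Hrho0 s Hs); intros Hr0.
    (* Only the sign and the square of [rho] are given; its differentiability comes from this root,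
       whose argument is positive. *)
    assert (Er : forall x, J x -> rho x = sqrt (w x ^ 2 + b ^ 2)).
    { intros x Hx; destruct (Hrho x Hx) as [Hr <-]; now rewrite sqrt_pow2. }
    apply (is_derive_ext_loc (fun x => sqrt (w x ^ 2 + b ^ 2))).
    { destruct (HJ s Hs) as [d Hd]; exists d; intros x Hx; symmetry.
      apply Er, Hd, Hx. }
    replace (p s / rho s)
      with ((2 * (p s / w s) * w s ^ 1 + 0) / (2 * sqrt (w s ^ 2 + b ^ 2)))
      by (rewrite <- Er by exact Hs; field; split; [lra | apply Hw, Hs]).
    apply (is_derive_sqrt (fun x => w x ^ 2 + b ^ 2)).
    - apply (is_derive_plus (fun x => w x ^ 2) (fun _ => b ^ 2)).
      + apply (is_derive_pow w 2), Dw, Hs.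
      + exact (is_derive_const (b ^ 2) s).
    - rewrite <- (proj2 (Hrho s Hs)); apply pow2_gt_0; lra. }
  (* The second derivatives are written out with [w' = p / w], [rho' = p / rho], [p' = 1 - 2 H q]
     and [q' = - 2 H p] already substituted. *)
  set (rho1 := fun s => p s / rho s).
  set (rho2 := fun s => (1 - 2 * H * q s) / rho s - p s ^ 2 / rho s ^ 3).
  set (t1 := fun s => w s * q s / (w s ^ 2 + b ^ 2)).
  set (t2 := fun s => (p s * q s / w s - 2 * H * w s * p s) / (w s ^ 2 + b ^ 2)
                      - 2 * w s * q s * p s / (w s ^ 2 + b ^ 2) ^ 2).
  set (Q1 := fun s => b * q s / (w s * (w s ^ 2 + b ^ 2))).
  set (Q2 := fun s => - b * (2 * H * p s / (w s * (w s ^ 2 + b ^ 2))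
                             + q s * p s / (w s ^ 3 * (w s ^ 2 + b ^ 2))
                             + 2 * q s * p s / (w s * (w s ^ 2 + b ^ 2) ^ 2))).
  (* The squares are spelled as [auto_derive] leaves them in its side conditions. *)
  assert (Hx : forall s, J s -> w s * (w s * 1) + b * (b * 1) <> 0).
  { intros s Hs; replace (w s * (w s * 1) + b * (b * 1)) with (rho s ^ 2)
      by (rewrite (proj2 (Hrho s Hs)); ring).
    apply pow_nonzero, Rgt_not_eq, Hrho0, Hs. }
  assert (Dw' : forall s, J s -> Derive (fun x => w x) s = p s / w s)
    by (intros s Hs; apply is_derive_unique, Dw, Hs).
  assert (Dp' : forall s, J s -> Derive (fun x => p x) s = 1 - 2 * H * q s)
    by (intros s Hs; apply is_derive_unique, Dp, Hs).
  assert (Drho' : forall s, J s -> Derive (fun x => rho x) s = p s / rho s)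
    by (intros s Hs; apply is_derive_unique, Drho, Hs).
  assert (Hside : forall s, J s -> ex_derive w s /\ ex_derive p s /\
    ex_derive rho s /\ w s <> 0 /\ rho s <> 0 /\
    w s * (w s * 1) + b * (b * 1) <> 0).
  { intros s Hs; split; [eexists; now apply Dw|]; split; [eexists; now apply Dp|].
    split; [eexists; now apply Drho|]; split; [apply Hw, Hs|].
    split; [apply Rgt_not_eq, Hrho0, Hs | apply Hx, Hs]. }
  (* As [rho^2 - b^2 = w^2], the right side is [w^2 (p^2 - q^2) / rho^2], and
     [p^2 - q^2 = rho^2]. *)
  assert (HW2 : forall s, J s ->
    w s ^ 2 = rho s ^ 2 * (rho1 s ^ 2 - t1 s ^ 2) - b ^ 2 * rho1 s ^ 2).
  { intros s Hs; destruct (Hside s Hs) as (_ & _ & _ & Hw0 & Hr0 & _).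
    destruct (Hrho s Hs) as [_ Hr2].
    unfold rho1, t1; rewrite <- Hr2.
    replace (rho s ^ 2 * ((p s / rho s) ^ 2 - (w s * q s / rho s ^ 2) ^ 2)
             - b ^ 2 * (p s / rho s) ^ 2)
      with (((rho s ^ 2 - b ^ 2) * p s ^ 2 - w s ^ 2 * q s ^ 2) / rho s ^ 2)
      by (field; exact Hr0).
    rewrite Hp, Hr2 by exact Hs; field; rewrite <- Hr2; now apply pow_nonzero. }
  destruct (helicoid_cmc J b (/ m) H rho rho1 rho2 t t1 t2 Q Q1 Q2 w Y
    (fun s v => hel_normal b rho t w s (th s v))) as [HY Hg]; trivial.
  - now apply Rinv_neq_0_compat.
  - apply C1_with_intro; intros s Hs; split; [now apply Drho|].
    destruct (Hside s Hs) as (? & ? & ? & ? & ? & ?).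
    unfold rho1; auto_derive; nonzero.
  - apply C1_with_intro; intros s Hs.
    destruct (Hside s Hs) as (? & ? & ? & ? & ? & ?).
    unfold rho2, rho1, q; split.
    + auto_derive; [nonzero|].
      rewrite Dp', Drho' by exact Hs; unfold q; field; trivial.
    + auto_derive; nonzero.
  - apply C1_with_intro; intros s Hs; split; [now apply Dt|].
    destruct (Hside s Hs) as (? & ? & ? & ? & ? & ?).
    unfold t1, q; auto_derive; nonzero.
  - apply C1_with_intro; intros s Hs.
    destruct (Hside s Hs) as (? & ? & ? & ? & ? & ?).
    unfold t2, t1, q; split.
    + auto_derive; [nonzero|].
      rewrite Dw' by exact Hs; field; split; trivial.
    + auto_derive; nonzero.
  - apply C1_with_intro; intros s Hs; split; [now apply DQ|].
    destruct (Hside s Hs) as (? & ? & ? & ? & ? & ?).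
    unfold Q1, q; auto_derive; nonzero.
  - apply C1_with_intro; intros s Hs.
    destruct (Hside s Hs) as (? & ? & ? & ? & ? & ?).
    unfold Q2, Q1, q; split.
    + auto_derive; [nonzero|].
      rewrite Dw' by exact Hs; field; split; trivial.
    + auto_derive; nonzero.
  - intros s Hs; destruct (Hside s Hs) as (? & ? & ? & ? & ? & ?); now split.
  - intros s Hs; destruct (Hside s Hs) as (_ & _ & _ & Hw0 & Hr0 & _).
    destruct (Hrho s Hs) as [_ Hr2].
    assert (Hp' : p s ^ 2 = q s ^ 2 + rho s ^ 2) by (rewrite Hp by exact Hs; lra).
    assert (Hb : b ^ 2 = rho s ^ 2 - w s ^ 2) by lra.
    unfold rho2, t2, rho1, t1; rewrite <- Hr2.
    (* In this form [p] and [b] occur only through their squares, so both can be eliminated by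
       rewriting, leaving a rational identity in [rho], [w], [q]. *)
    transitivity ((rho s ^ 2 - b ^ 2) *
        (w s * q s / rho s ^ 2 * (1 - 2 * H * q s - p s ^ 2 / rho s ^ 2)
         - p s ^ 2 / rho s ^ 2 * (q s / w s - 2 * H * w s - 2 * w s * q s / rho s ^ 2))
      + 2 * b ^ 2 * (w s * q s / rho s ^ 2) * (p s ^ 2 / rho s ^ 2)
      - (p s ^ 2 / rho s ^ 2 - w s ^ 2 * q s ^ 2 / rho s ^ 4) * (w s * q s)).
    + rewrite Hp', Hb; field; easy.
    + field; easy.
  - split; [|split; [|split; [exact HY|]]].
    + split; [exact Hrho0|].
      intros x; unfold Y; split.
      * intros (s & v & Hs & Hx'); now exists s, (th s v).
      * intros (s & v & Hs & Hx'); exists s, (m * (v - Q s)); split; [exact Hs|].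
        replace (th s (m * (v - Q s))) with v by (unfold th; field; exact Hm).
        exact Hx'.
    + intros s Hs; rewrite HW2 by exact Hs; unfold hel_W2.
      now rewrite (is_derive_unique rho s _ (Drho s Hs)),
        (is_derive_unique t s _ (Dt s Hs)).
    + destruct (C1_on_intro J (fun s _ => s) (fun _ _ => 1) (fun _ _ => 0))
        as [SC SD]; trivial.
      1: intros s v _; exact (is_derive_id s).
      1: intros s v _; exact (is_derive_const s v).
      1, 2: intros; apply continuity_2d_pt_const.
      destruct (C1_on_intro J (fun _ v => v) (fun _ _ => 0) (fun _ _ => 1))
        as [TC TD]; trivial.
      1: intros s v _; exact (is_derive_const v s).
      1: intros s v _; exact (is_derive_id v).
      1, 2: intros; apply continuity_2d_pt_const.
      split; [exact SC|]; split; [exact TC|]; split; [now split|]; split.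
      * now intros s v s' v' _ _ -> ->.
      * intros s v Hs; destruct (SD s v Hs) as [-> ->], (TD s v Hs) as [-> ->],
          (Hg s v Hs) as (-> & -> & ->).
        destruct (Hside s Hs) as (_ & _ & _ & Hw0 & Hr0 & _).
        destruct (Hrho s Hs) as [_ Hr2]; destruct (Hw s Hs) as [HwU _].
        assert (Hp' : p s ^ 2 = q s ^ 2 + rho s ^ 2)
          by (rewrite Hp by exact Hs; lra).
        assert (Hb : b ^ 2 = rho s ^ 2 - w s ^ 2) by lra.
        (* The claim is [E = 1], [F = 0], [G = U^2]. Orthogonality [rho^2 Q1 = b (t1 + b Q1)] is
           what determines [Q1]. *)
        unfold rho1, t1, Q1; rewrite <- Hr2; repeat split.
        -- transitivity (p s ^ 2 / rho s ^ 2 + b ^ 2 * q s ^ 2 / (w s * rho s) ^ 2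
             - (w s ^ 2 + b ^ 2) ^ 2 * q s ^ 2 / (w s * rho s ^ 2) ^ 2);
             [field; easy|].
           rewrite Hp', Hb; field; easy.
        -- transitivity (/ m * (b * q s / w s
             - b * q s * (w s ^ 2 + b ^ 2) / (w s * rho s ^ 2))); [field; easy|].
           rewrite <- Hr2; field; easy.
        -- rewrite Hr2.
           replace (w s ^ 2 + b ^ 2 - b ^ 2) with (w s ^ 2) by ring.
           rewrite HwU; field; exact Hm.
Qed.

(** In both cases [m^2 U^2 = f - k], where [f] has a partner [f1] with [f' = 2 H f1], [f1' = 2 H f]
    and [f1^2 - f^2 = d]; the sign of [d] decides which of the two is the [sinh]. Then [p = H f1],
    which gives both claims. *)
Lemma cmc_U_regular (J : R -> Prop) (H I b m s0 : R) (U : R -> R) :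
  open J -> H <> 0 -> m <> 0 ->
  (forall s, J s -> cmc_U_equation H I b m s0 U s) ->
  (forall s, J s -> ex_derive U s /\ U s <> 0) ->
  let q := fun s => cmc_a H I b - H * (m * U s) ^ 2 in
  let p := fun s => m ^ 2 * U s * Derive U s in
  forall s, J s ->
    is_derive p s (1 - 2 * H * q s) /\
    p s ^ 2 = q s ^ 2 + (m * U s) ^ 2 + b ^ 2.
Proof.
  intros HJ HH Hm HU HD q p.
  set (k := (1 - 2 * H * cmc_a H I b) / (2 * H ^ 2)).
  set (d := cmc_disc H I b / (4 * H ^ 4)).
  assert (H2 : 0 < H ^ 2) by now apply pow2_gt_0.
  assert (H4 : 0 < 4 * H ^ 4) by (replace (H ^ 4) with (H ^ 2 * H ^ 2) by ring; nra).
  set (c := cmc_c H I b).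
  assert (Hex : exists f f1 : R -> R,
    (forall s, is_derive f s (2 * H * f1 s) /\ is_derive f1 s (2 * H * f s) /\
               f1 s ^ 2 - f s ^ 2 = d) /\
    forall s, J s -> m ^ 2 * U s ^ 2 = f s - k).
  { assert (Hcs : forall x, cosh x ^ 2 - sinh x ^ 2 = 1)
      by (intros x; unfold cosh, sinh; rewrite exp_Ropp; field;
          apply Rgt_not_eq, exp_pos).
    assert (Hc2 : c ^ 2 = Rabs d)
      by (unfold c, cmc_c; rewrite pow2_sqrt; [reflexivity | apply Rabs_pos]).
    assert (Ds : forall s, is_derive (fun s => c * sinh (2 * H * (s - s0))) s
                             (2 * H * (c * cosh (2 * H * (s - s0))))).
    { intros s; replace (2 * H * (c * cosh (2 * H * (s - s0))))
        with (c * (2 * H * cosh (2 * H * (s - s0)))) by ring.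
      apply is_derive_scal, (is_derive_comp sinh (fun s => 2 * H * (s - s0))).
      - apply is_derive_Reals, derivable_pt_lim_sinh.
      - auto_derive; trivial; ring. }
    assert (Dc : forall s, is_derive (fun s => c * cosh (2 * H * (s - s0))) s
                             (2 * H * (c * sinh (2 * H * (s - s0))))).
    { intros s; replace (2 * H * (c * sinh (2 * H * (s - s0))))
        with (c * (2 * H * sinh (2 * H * (s - s0)))) by ring.
      apply is_derive_scal, (is_derive_comp cosh (fun s => 2 * H * (s - s0))).
      - apply is_derive_Reals, derivable_pt_lim_cosh.
      - auto_derive; trivial; ring. }
    (* A zero discriminant falls into the second branch, where [c] and [d] vanish and the identities
       persist; at points of [J] the equation for [U] rules it out. *)
    destruct (Rlt_le_dec 0 (cmc_disc H I b)) as [Hd|Hd].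
    - exists (fun s => c * sinh (2 * H * (s - s0))),
        (fun s => c * cosh (2 * H * (s - s0))); split.
      + intros s; split; [apply Ds|]; split; [apply Dc|].
        rewrite !Rpow_mult_distr, Hc2, <- Rmult_minus_distr_l, Hcs, Rmult_1_r.
        apply Rabs_pos_eq, Rlt_le, Rdiv_lt_0_compat; assumption.
      + intros s Hs; destruct (HU s Hs) as [[_ E]|[Hd' _]]; [exact E | lra].
    - exists (fun s => c * cosh (2 * H * (s - s0))),
        (fun s => c * sinh (2 * H * (s - s0))); split.
      + intros s; split; [apply Dc|]; split; [apply Ds|].
        rewrite !Rpow_mult_distr, Hc2, <- Rmult_minus_distr_l.
        replace (sinh (2 * H * (s - s0)) ^ 2 - cosh (2 * H * (s - s0)) ^ 2)
          with (-1) by (generalize (Hcs (2 * H * (s - s0))); lra).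
        rewrite Rabs_left1; [ring|].
        unfold d, Rdiv; generalize (Rinv_0_lt_compat _ H4); nra.
      + intros s Hs; destruct (HU s Hs) as [[Hd' _]|[_ E]]; [lra | exact E]. }
  destruct Hex as (f & f1 & Hf & HfU).
  assert (Hp : forall s, J s -> p s = H * f1 s).
  { intros s Hs; destruct (HD s Hs) as [[U1 DU] _].
    unfold p; rewrite (is_derive_unique U s _ DU).
    (* Both sides of [m^2 U^2 = f - k] are differentiated at [s], the equality holding near [s]. *)
    assert (E : m ^ 2 * (2 * U1 * U s ^ 1) = 2 * H * f1 s + 0).
    { transitivity (Derive (fun x => m ^ 2 * U x ^ 2) s).
      - symmetry; apply is_derive_unique, is_derive_scal, (is_derive_pow U 2), DU.
      - apply is_derive_unique.
        apply (is_derive_ext_loc (fun x => f x + - k)).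
        + destruct (HJ s Hs) as [e He]; exists e; intros x Hx; symmetry.
          apply HfU, He, Hx.
        + apply (is_derive_plus f (fun _ => - k)); [apply Hf|].
          exact (is_derive_const (- k) s). }
    lra. }
  intros s Hs; destruct (Hf s) as (_ & Df1 & Hff).
  assert (Hq : (m * U s) ^ 2 = f s - k) by (rewrite <- HfU by exact Hs; ring).
  split.
  - apply (is_derive_ext_loc (fun x => H * f1 x)).
    + destruct (HJ s Hs) as [e He]; exists e; intros x Hx; symmetry.
      apply Hp, He, Hx.
    + replace (1 - 2 * H * q s) with (H * (2 * H * f s)); [now apply is_derive_scal|].
      unfold q; rewrite Hq; unfold k; field; exact HH.
  - rewrite Hp by exact Hs; unfold q; rewrite Hq.
    replace ((H * f1 s) ^ 2) with (H ^ 2 * (f s ^ 2 + d)) by (rewrite <- Hff; ring).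
    unfold k, d, cmc_disc; field; exact HH.
Qed.

Lemma sign_mul_sqrt_sqr (x : R) : sign x * sqrt (x ^ 2) = x.
Proof.
  destruct (Rtotal_order x 0) as [Hx|[->|Hx]].
  - rewrite sign_eq_m1 by exact Hx.
    replace (x ^ 2) with ((- x) ^ 2) by ring; rewrite sqrt_pow2; lra.
  - rewrite sign_0; ring.
  - rewrite sign_eq_1 by exact Hx; rewrite sqrt_pow2; lra.
Qed.

(** * Both families together *)

Theorem theorem3 :
  (* (a) *)
  ((forall (I b m : R) (t : R -> R) (ttheta : R -> R -> R),
      I <> 0 -> m <> 0 -> maximal_family I b m t ttheta ->
      let rho := fun r : R => r in
      let J := fun r : R => Rabs b < r in
      let D := fun r theta : R => J r in
      let X := fun r theta : R => cyl r theta (t r + b * theta) in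
      parametrizes_helicoidal b J rho t D X /\
      space_like_cmc_surface D X
        (hel_normal b rho t (fun r => sqrt (hel_W2 b rho t r))) 0 /\
      (exists (S : R -> R -> R) (U : R -> R) (T : R -> R -> R) (k : R),
         natural_parameters D X S U T /\ k <> 0 /\
         forall r theta, D r theta -> ttheta r theta = k * T r theta))
   /\
   (forall I : R, I <> 0 ->
      exists (t : R -> R) (ttheta : R -> R -> R),
        maximal_family (Rabs I) 0 1 t ttheta /\
        forall p : L3,
          (exists r theta, Rabs 0 < r /\ p = cyl r theta (t r + 0 * theta)) <->
          (exists tau theta, 0 < I * sinh (tau / I) /\
             p = cyl (I * sinh (tau / I)) theta tau)))
  /\
  (* (b) *)
  (forall (H I b s0 m : R) (lo hi : Rbar) (U rho t Q : R -> R),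
     H <> 0 -> m <> 0 ->
     let J := fun s : R => Rbar_lt lo s /\ Rbar_lt s hi in
     (forall s, J s -> cmc_U_equation H I b m s0 U s) ->
     (forall s, J s ->
        ex_derive U s /\ U s <> 0 /\ 0 <= cmc_radicand b m U s) ->
     (forall s, J s -> 0 <= rho s /\ rho s ^ 2 = m ^ 2 * U s ^ 2 + b ^ 2) ->
     primitive_on J (cmc_dt H I b m U) t ->
     primitive_on J (cmc_dtheta H I b m U) Q ->
     let theta := fun s ttheta : R => ttheta / m + Q s in
     let D := fun s ttheta : R => J s in
     let Y := fun s ttheta : R =>
       cyl (rho s) (theta s ttheta) (t s + b * theta s ttheta) in
     let W := fun s : R => m * U s in
     parametrizes_helicoidal b J rho t D Y /\
     (forall s, J s -> W s ^ 2 = hel_W2 b rho t s) /\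
     space_like_cmc_surface D Y
       (fun s ttheta => hel_normal b rho t W s (theta s ttheta)) H /\
     natural_parameters D Y (fun s _ => s) U (fun _ ttheta => ttheta)).
Proof.
  split; [split|].
  - intros I b m t ttheta HI Hm (Ht & Q & HQ & Htt) rho J D X.
    destruct (maximal_helicoid_natural I b t Q Ht HQ) as (HP & HS & HN).
    split; [exact HP|]; split; [exact HS|].
    (* The constant multiple is [m], as the given angle is [m * (theta - b * I * Q r)]. *)
    eexists _, _, _, m; split; [exact HN|]; split; [exact Hm|].
    intros r theta Hr; rewrite Htt by exact Hr; ring.
  - intros I HI.
    assert (HK : 0 < Rabs I) by now apply Rabs_pos_lt.
    exists (fun r => Rabs I * arcsinh (r / Rabs I)), (fun _ theta => theta).
    split; [now apply catenoid_family|].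
    intros x; rewrite catenoid_points by exact HK.
    split; intros (tau & theta & Hp); exists tau, theta;
      revert Hp; now rewrite (scaled_sinh_abs I tau HI).
  - intros H I b s0 m lo hi U rho t Q HH Hm J HU HUd Hrho Ht HQ theta D Y W.
    assert (HJ : open J) by (apply open_and; [apply open_Rbar_gt | apply open_Rbar_lt]).
    assert (HD : forall s, J s -> ex_derive U s /\ U s <> 0)
      by (intros s Hs; split; apply HUd, Hs).
    pose proof (cmc_U_regular J H I b m s0 U HJ HH Hm HU HD) as Hp; cbv zeta in Hp.
    (* The first integral makes the radicand a square, so the signed root becomes a polynomial in
       [U], also where it vanishes. *)
    assert (Hroot : forall s, J s ->
      cmc_root H I b m U s = cmc_a H I b - H * (m * U s) ^ 2).
    { intros s Hs; destruct (Hp s Hs) as [_ Hp2].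
      unfold cmc_root.
      replace (cmc_radicand b m U s) with ((cmc_a H I b - H * (m * U s) ^ 2) ^ 2)
        by (unfold cmc_radicand; lra).
      replace (H * m ^ 2 * U s ^ 2) with (H * (m * U s) ^ 2) by ring.
      apply sign_mul_sqrt_sqr. }
    apply (cmc_helicoid_natural J b H (cmc_a H I b) m U W
             (fun s => m ^ 2 * U s * Derive U s)); trivial.
    + intros s Hs; split; [reflexivity|].
      apply Rmult_integral_contrapositive_currified; [exact Hm | apply HD, Hs].
    + intros s Hs; destruct (HD s Hs) as [HUs HU0].
      replace (m ^ 2 * U s * Derive U s / W s) with (m * Derive U s)
        by (unfold W; field; easy).
      apply is_derive_scal, Derive_correct, HUs.
    + intros s Hs; apply Hp, Hs.
    + intros s Hs; apply Hp, Hs.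
    + intros s Hs; destruct (Hrho s Hs) as [Hr Hr2]; split; [exact Hr|].
      rewrite Hr2; unfold W; ring.
    + intros s Hs; match goal with |- is_derive _ _ ?l =>
        replace l with (cmc_dt H I b m U s); [exact (Ht s Hs)|] end.
      unfold cmc_dt; rewrite Hroot by exact Hs.
      replace (m ^ 2 * U s ^ 2) with (W s ^ 2) by (unfold W; ring).
      unfold Rdiv, W; ring.
    + intros s Hs; match goal with |- is_derive _ _ ?l =>
        replace l with (cmc_dtheta H I b m U s); [exact (HQ s Hs)|] end.
      unfold cmc_dtheta; rewrite Hroot by exact Hs.
      replace (m ^ 2 * U s ^ 2) with (W s ^ 2) by (unfold W; ring).
      unfold Rdiv, W; ring.
Qed.
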